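(* Let $S$ be an infinite discrete semigroup that is countable, weakly cancellative, and has a uniform, finite bound on $|\mathrm{Fix}(a)|$ for $a\in S$ (i.e. there is $k\in\mathbb{N}$ with $|\mathrm{Fix}(a)|\le k$ for all $a\in S$). Let $R$ be a minimal right ideal of $S^*$. Then $E(R)$ is not Borel in $\beta S$, nor is $q\cdot E(R)$ for any $q\in R$.
   Context: $\beta S$ is the set of ultrafilters on $S$ (principal ultrafilters identified with points of $S$), with the topology whose basic clopen sets are $\overline{A}=\{p\in\beta S: A\in p\}$, $A\subseteq S$; $S^*=\beta S\setminus S$. The operation of $S$ extends to $\beta S$ by: $A\in p\cdot q$ iff $\{x\in S: x^{-1}A\in q\}\in p$, where $x^{-1}A=\{y\in S: x\cdot y\in A\}$. This makes $\beta S$ a compact Hausdorff right topological semigroup. $E(R)$ is the set of idempotents in $R$, and $q\cdot E(R)=\{q\cdot e: e\in E(R)\}$. $S$ is weakly cancellative if for all $a,b\in S$ the sets $\{x\in S: ax=b\}$ and $\{x\in S: xa=b\}$ are finite. In this case $S^*$ is a two-sided ideal of $\beta S$ (hence a semigroup), and the minimal right ideals of $S^*$ are exactly those of $\beta S$. For $a\in S$, $\mathrm{Fix}(a)=\{x\in S: xa=a\}$. A Borel set is a member of the $\sigma$-algebra generated by the open sets. *)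

(* Defs.v *)
From HB Require Import structures.
From mathcomp Require Import all_boot.
From mathcomp Require Import all_classical topology measure.

Set Implicit Arguments.
Unset Strict Implicit.
Unset Printing Implicit Defensive.

Local Open Scope classical_set_scope.
Local Open Scope group_scope.

(* The Stone-Cech compactification of the discrete space [S], with basic
   clopen sets [beta_basic A]. *)
Record beta (S : Type) := Beta {
  ultra :> (S -> Prop) -> Prop ;
  ultraP : UltraFilter ultra
}.

#[global] Existing Instance ultraP.

HB.instance Definition _ (S : Type) := gen_eqMixin (beta S).
HB.instance Definition _ (S : Type) := gen_choiceMixin (beta S).

Lemma beta_eqP (S : Type) (p q : beta S) :
  (forall A : set S, p A <-> q A) -> p = q.
Proof.
case: p q => [p pU] [q qU] /= pq.
have {}pq : p = q by apply/funext => A; apply/propext; exact: pq.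
by case: q / pq qU => qU; congr Beta; exact: Prop_irrelevance.
Qed.

(* The point of [beta S] identified with [x : S]. *)
Definition principal (S : Type) (x : S) : beta S :=
  Beta (principal_filter_ultra x).

Definition remainder (S : Type) : set (beta S) := ~` range (@principal S).
Arguments remainder : clear implicits.

Definition beta_basic (S : Type) (A : set S) : set (beta S) := [set p | p A].

Section topology.
Variable S : Type.

Let beta_basic_cover : \bigcup_(A in setT) @beta_basic S A = setT.
Proof.
by apply/seteqP; split=> // p _; exists setT => //; exact: filterT.
Qed.

Let beta_basic_join (A B : set S) (p : beta S) : setT A -> setT B ->
  beta_basic A p -> beta_basic B p ->
  exists C, [/\ setT C, beta_basic C p &
                beta_basic C `<=` beta_basic A `&` beta_basic B].
Proof.
move=> _ _ pA pB; exists (A `&` B); split => //; first exact: filterI.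
by move=> q qAB; split; apply: (@filterS _ q _ (A `&` B)) qAB => x [].
Qed.

HB.instance Definition _ :=
  isBaseTopological.Build (beta S) beta_basic_cover beta_basic_join.

End topology.

Section product.
Variable S : semigroupType.
Implicit Types p q r : beta S.

Definition beta_mul_sets p q : set_system S :=
  [set A | p [set x | q [set y | A (x * y)]]].

Lemma beta_mul_ultra p q : UltraFilter (beta_mul_sets p q).
Proof.
have F : ProperFilter (beta_mul_sets p q).
  apply: Build_ProperFilter_ex.
    move=> A pA; have [x qA] := @filter_ex _ p _ _ pA.
    by have [y Axy] := @filter_ex _ q _ _ qA; exists (x * y).
  split.
  - by apply: (@filterS _ p _ setT) (@filterT _ p _) => x _; exact: filterT.
  - move=> A B pA pB; apply: (@filterS _ p) (@filterI _ p _ _ _ pA pB).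
    by move=> x [qA qB]; exact: (@filterI _ q).
  - move=> A B AB; apply: (@filterS _ p) => x; apply: (@filterS _ q) => y.
    exact: AB.
split=> // G GF FG; apply/seteqP; split=> [A GA|]; last exact: FG.
have [//|pnA] := in_ultra_setVsetC [set x | q [set y | A (x * y)]] (ultraP p).
have /FG GnA : beta_mul_sets p q (~` A).
  apply: (@filterS _ p) pnA => x nqA.
  by have [] := in_ultra_setVsetC [set y | A (x * y)] (ultraP q).
by have [x []] := filter_ex (filterI GA GnA).
Qed.

Definition beta_mul p q : beta S := Beta (beta_mul_ultra p q).

Lemma beta_mulA : associative beta_mul.
Proof.
move=> p q r; apply: beta_eqP => A /=; rewrite /beta_mul_sets /=.
suff -> : (fun x => q [set y | r [set z | A (x * (y * z))]]) =
          (fun x => q [set y | r [set z | A (x * y * z)]]) by [].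
apply/funext => x; congr (q _); apply/funext => y; congr (r _).
by apply/funext => z; rewrite /= mulgA.
Qed.

HB.instance Definition _ := isSemigroup.Build (beta S) beta_mulA.

End product.

Definition weakly_cancellative (S : magmaType) : Prop :=
  forall a b : S, finite_set [set x | a * x = b] /\
                  finite_set [set x | x * a = b].

Definition Fix (S : magmaType) (a : S) : set S := [set x | x * a = a].

(* [R] is a right ideal of the subsemigroup [T] of [G]; right ideals are
   nonempty. *)
Definition right_ideal (G : magmaType) (T R : set G) : Prop :=
  [/\ R !=set0, R `<=` T & forall x y, R x -> T y -> R (x * y)].

Definition minimal_right_ideal (G : magmaType) (T R : set G) : Prop :=
  right_ideal T R /\
  forall R' : set G, right_ideal T R' -> R' `<=` R -> R' = R.

Definition idempotents (G : magmaType) (R : set G) : set G :=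
  [set e | R e /\ e * e = e].

Definition Borel (T : topologicalType) : set (set T) := <<s @open T >>.

(* Main.v *)
Require Import Defs.
From mathcomp Require Import all_boot.
From mathcomp Require Import all_classical topology measure.

Local Open Scope classical_set_scope.
Local Open Scope card_scope.

Set Implicit Arguments.
Unset Strict Implicit.
Unset Printing Implicit Defensive.

(** Write W for a set q E(R) with q in R. The set E(R) is itself of this form:
    an idempotent e of R satisfies e y = y for every y in R (as R = e S^* by
    minimality), so E(R) = e E(R). Three facts together show that W is not
    Borel; E below stands for E(R).

    First, a closed subset K of W is finite ([compact_translate_finite]). If K
    were infinite, pick distinct points x_0, x_1, ... of K and let y = q e be
    their limit along a nonprincipal ultrafilter on the integers; y lies in K.
    For e, f in E we have f e = e, so right multiplication by e maps all of K
    to y. Let T be the set of the t in S with t y = y. Suppose T is not in e.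
    Then y = e y is in the closure of the t y with t outside T, and also in
    the closure of the x_n that differ from y. Two countable subsets of beta S
    neither of which meets the closure of the other have disjoint closures
    ([frolik]), so one of two things happens. Either some x_n other than y is
    a limit of points t y, that is x_n = w y with w in beta S, and then
    x_n = x_n e = y; or some t y with t outside T is in K, and then
    t y = (t y) e = y. Both are absurd, so T belongs to the nonprincipal
    ultrafilter e and is infinite. Now t y = y implies that y contains the
    set of the a with t a = a ([katetov]). Intersecting these sets for k + 1
    elements t of T gives some a for which Fix(a) has more than k elements.

    Secondly, in a space where every open set is a union of members of a fixed
    family of continuum many closed sets, the sets that are, together with
    their complement, a union of continuum many closed sets form a
    sigma-algebra containing the open sets ([Borel_code_union_closed]). As S
    is countable, the basic clopen sets of beta S are such a family. A Borel W
    is thus a union of continuum many finite sets, hence is enumerated by a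
    family h indexed by the continuum.

    Thirdly, W is too large for that. A sparse sequence x_n in S gives, for
    each set B of integers, a set P(B) containing s x_n for every s in S and
    almost all n in B, with P(B) disjoint from P(~B) ([ultrafilter_coding]).
    So a nonprincipal ultrafilter p on the integers can be read off any point
    of the closed left ideal generated by the image of p, and each such ideal
    meets W because it meets E ([idempotent_above_filter]). There is an
    independent family of sets I_j of integers indexed by the continuum, so
    that p can be prescribed at all the I_j at once
    ([trace_set_independent]). Requiring I_j to be in p exactly when P(I_j) is
    not in h(j) produces a point of W that differs from all the h(j). *)

(** * Ultrafilters as points of beta S *)

Section Ultrafilters.
Variable S : Type.
Implicit Types (p q y : beta S) (A B : set S).

Lemma betaS p A B : A `<=` B -> p A -> p B.
Proof. by move=> AB; apply: (@filterS _ p). Qed.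

Lemma betaI p A B : p A -> p B -> p (A `&` B).
Proof. exact: (@filterI _ p). Qed.

Lemma beta_ex p A : p A -> A !=set0.
Proof. by move=> pA; have [x Ax] := @filter_ex _ p _ _ pA; exists x. Qed.

Lemma betaC p A : p (~` A) <-> ~ p A.
Proof.
split=> [pnA pA|npA].
  by have [x [nAx /nAx]] := beta_ex (betaI pnA pA).
by have [] := in_ultra_setVsetC A (ultraP p).
Qed.

Lemma beta_le_eq p q : (forall A, p A -> q A) -> p = q.
Proof.
move=> pq; apply: beta_eqP => A; split; first exact: pq.
by move=> qA; apply/not_notP => /betaC/pq/betaC.
Qed.

Lemma filter_beta (F : set_system S) :
  ProperFilter F -> exists p : beta S, F `<=` p.
Proof.
by move=> /ultraFilterLemma[G [GU FG]]; exists (Beta GU).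
Qed.

Lemma beta_basic_closed A : closed (beta_basic A).
Proof.
rewrite -openC; suff -> : ~` beta_basic A = beta_basic (~` A).
  by exists [set ~` A] => //; rewrite bigcup_set1.
by apply/seteqP; split=> p /betaC.
Qed.

Lemma open_beta_basic (U : set (beta S)) p :
  open U -> U p -> exists2 A, p A & beta_basic A `<=` U.
Proof.
move=> [D _ <-] [A DA pA]; exists A => // q qA; by exists A.
Qed.

Lemma closed_beta_sep (K : set (beta S)) p : closed K -> ~ K p ->
  exists2 A, p A & forall q, K q -> ~ q A.
Proof.
move=> Kcl nKp; have Kop : open (~` K) by rewrite openC.
have [A pA AK] := open_beta_basic Kop nKp.
by exists A => // q Kq qA; exact: (AK q qA).
Qed.

Lemma cofinite_remainder p :
  (forall x, p (~` [set x])) -> remainder S p.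
Proof.
by move=> pt [x _ xp]; have := pt x; rewrite -xp => /principal_filterP; apply.
Qed.

End Ultrafilters.

Lemma remainder_cofinite (S : Type) (p : beta S) (A : set S) :
  remainder S p -> finite_set A -> p (~` A).
Proof.
move=> pS Afin; have pt x : p (~` [set x]).
  apply/betaC => px; apply: pS; exists x => //; apply: beta_le_eq => B Bx.
  by apply: betaS px => _ ->; exact/principal_filterP.
elim/Pchoice: S => T in p A pS Afin pt *.
case/finite_fsetP: Afin => X ->.
have := @filter_bigI T T X (fun x => ~` [set x]) p _ (fun x _ => pt x).
by move=> /(_ _)/betaS; apply=> y Xy yX; exact: (Xy y).
Qed.

Lemma beta_ord_bigI (S : Type) (p : beta S) (F : nat -> set S) n :
  (forall i, (i < n)%N -> p (F i)) ->
  p [set x | forall i, (i < n)%N -> F i x].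
Proof.
elim: n => [|n IHn] pF; first by apply: betaS (@filterT _ p _) => x _.
have := betaI (pF n (ltnSn n)) (IHn (fun i lt_in => pF i (ltnW lt_in))).
by apply: betaS => x [Fn Fi] i; rewrite ltnS leq_eqVlt => /predU1P[->|/Fi].
Qed.

Lemma infinite_injection (T : Type) (A : set T) : infinite_set A ->
  exists g : nat -> T, injective g /\ forall n, A (g n).
Proof.
move=> /infiniteP/card_leP[g].
pose top (n : nat) : [set: nat] := SigSub (mem_set (I : [set: nat] n)).
exists (fun n => \val (g (top n))); split=> [m n /val_inj eqg|n]; last first.
  exact: set_valP.
have /(congr1 val) // : top m = top n by apply: inj eqg; rewrite ?inE.
Qed.

Lemma nonprincipal_nat : exists p : beta nat, remainder nat p.
Proof.
have [p cofp] := @filter_beta _ (\oo : set_system nat) _.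
exists p; apply: cofinite_remainder => n; apply: cofp; exists n.+1 => // m /=.
by move=> /[swap] ->; rewrite ltnn.
Qed.

Lemma beta_limit (S : Type) (p : beta nat) (x : nat -> beta S) :
  exists y : beta S, forall A, y A <-> p [set n | x n A].
Proof.
have [|y py] := @filter_beta _ [set A | p [set n | x n A]].
  apply: Build_ProperFilter_ex => [A pA|].
    by have [n /beta_ex] := beta_ex pA.
  split => /=.
  - by apply: betaS (@filterT _ p _) => n _; exact: filterT.
  - by move=> A B pA pB; apply: betaS (betaI pA pB) => n [] /=; exact: betaI.
  - by move=> A B AB; apply: betaS => n; exact: betaS.
exists y => A; split=> [yA|]; last exact: py.
apply/not_notP => /betaC pnA; suff /betaC : y (~` A) by [].
by apply: py; apply: betaS pnA => n /betaC.
Qed.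

(** The classical disjointification: writing A_n for a neighbourhood of a_n
    avoiding all the b_m, and B_m for one of b_m avoiding all the a_n, remove
    from A_n the finitely many B_m with m <= n. The union of what remains is
    in every a_n and misses B_m minus A_0, ..., A_(m-1), which is in b_m. *)
Lemma frolik (S : Type) (a b : nat -> beta S) :
  (forall n, exists2 A, a n A & forall m, ~ b m A) ->
  (forall m, exists2 B, b m B & forall n, ~ a n B) ->
  exists D, (forall n, a n D) /\ (forall m, b m (~` D)).
Proof.
move=> sepa sepb.
have /choice[A aA] n : exists A, a n A /\ forall m, ~ b m A.
  by have [A ? ?] := sepa n; exists A.
have /choice[B bB] m : exists B, b m B /\ forall n, ~ a n B.
  by have [B ? ?] := sepb m; exists B.
exists [set x | exists2 n, A n x & forall m, (m < n.+1)%N -> (~` B m) x].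
split=> k.
  have nB : forall m, (m < k.+1)%N -> a k (~` B m).
    by move=> m _; apply/betaC; case: (bB m) => _; exact.
  by apply: betaS (betaI (aA k).1 (beta_ord_bigI nB)) => x [Ax nBx]; exists k.
have nA : forall n, (n < k)%N -> b k (~` A n).
  by move=> n _; apply/betaC; case: (aA n) => _; exact.
apply: betaS (betaI (bB k).1 (beta_ord_bigI nA)) => x [Bx nAx] [n Ax nBx].
by have [/nAx|/nBx] := ltnP n k.
Qed.

(** * Maps fixing an ultrafilter *)

(** A point x and its image f x are joined by an edge; a two-colouring of the
    edges issued from D shows that an f-invariant ultrafilter does not contain
    D. For S countable, ranked by [rk], the non-fixed points split into those
    where f lowers the rank and those where it raises it. On each part the
    graph is a forest, since a point issues at most one edge and the rank is
    monotone along edges; hence it is two-colourable. *)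
Section Katetov.
Variables (S : Type) (f : S -> S).

Lemma bicolored_not_invariant (p : beta S) (D : set S) (c : S -> bool) :
  (forall A, p A -> p (f @^-1` A)) ->
  (forall x, D x -> c x <> c (f x)) -> ~ p D.
Proof.
move=> pf Dc pD.
have [pc|/betaC pc] := pselect (p [set x | c x]).
  have [x [Dx [/= cx cfx]]] := beta_ex (betaI pD (betaI pc (pf _ pc))).
  by apply: (Dc x Dx); rewrite cx cfx.
have [x [Dx [/= cx cfx]]] := beta_ex (betaI pD (betaI pc (pf _ pc))).
by apply: (Dc x Dx); move/negP/negbTE: cx => ->; move/negP/negbTE: cfx => ->.
Qed.

Variable rk : S -> nat.

(** Colourings that are correct below every bound M have a limit along a
    nonprincipal ultrafilter on M. *)
Lemma bicoloring_compact (D : set S) :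
  (forall M, exists c : S -> bool,
     forall x, D x -> (rk x < M)%N -> c x <> c (f x)) ->
  exists c : S -> bool, forall x, D x -> c x <> c (f x).
Proof.
move=> /choice[c cP]; have [u ru] := nonprincipal_nat.
exists (fun x => `[< u [set M | c M x] >]) => x Dx.
have big : u [set M | (rk x < M)%N].
  apply: betaS (remainder_cofinite ru (finite_II (rk x).+1)) => M /= /negP.
  by rewrite -leqNgt.
have [ux|/betaC ux] := pselect (u [set M | c M x]).
  rewrite (asboolT ux) => /esym/asboolP ufx.
  have [M [/= xM [cx cfx]]] := beta_ex (betaI big (betaI ux ufx)).
  by apply: (cP M x Dx xM); rewrite cx cfx.
rewrite (asboolF (proj1 (betaC _ _) ux)) => /esym/asboolP/betaC ufx.
have [M [/= xM [cx cfx]]] := beta_ex (betaI big (betaI ux ufx)).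
apply: (cP M x Dx xM).
by move/negP/negbTE: cx => ->; move/negP/negbTE: cfx => ->.
Qed.

Lemma bicoloring_down :
  exists c : S -> bool, forall x, (rk (f x) < rk x)%N -> c x <> c (f x).
Proof.
apply: (@bicoloring_compact [set x | (rk (f x) < rk x)%N]).
elim=> [|M [c cP]]; first by exists (fun=> true).
exists (fun z => if rk z == M then ~~ c (f z) else c z) => x /= fx_lt.
rewrite ltnS leq_eqVlt => /predU1P[xM|xM].
  by rewrite xM eqxx ltn_eqF -?xM //; case: (c (f x)).
by rewrite !ltn_eqF ?(ltn_trans fx_lt) //; exact: cP.
Qed.

(** Vertices below M are coloured in decreasing order of rank: a vertex takes
    the colour opposite to that of its image, and this affects no edge issued
    from a vertex already treated. *)
Lemma bicoloring_up :
  exists c : S -> bool, forall x, (rk x < rk (f x))%N -> c x <> c (f x).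
Proof.
apply: (@bicoloring_compact [set x | (rk x < rk (f x))%N]) => M.
suff below k : exists c : S -> bool, forall x, (rk x < rk (f x))%N ->
    (M - k <= rk x < M)%N -> c x <> c (f x).
  by have [c cP] := below M; exists c => x fx_gt xM; apply: cP; rewrite ?subnn.
elim: k => [|k [c cP]].
  by exists (fun=> true) => x _; rewrite subn0 leqNgt; case: (rk x < M)%N.
(* If k >= M then M - k.+1 = M - k = 0: vertices of rank 0 are recoloured, which
   is harmless since an edge that raises the rank never ends there. *)
exists (fun z => if rk z == (M - k.+1)%N then ~~ c (f z) else c z).
move=> x fx_gt /andP[]; rewrite leq_eqVlt => /predU1P[xM _|xM x_lt].
  by rewrite -xM eqxx gtn_eqF ?xM //; case: (c (f x)).
rewrite (gtn_eqF xM) (gtn_eqF (ltn_trans xM fx_gt)); apply: cP => //.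
by rewrite x_lt andbT; move: xM; rewrite subnS; case: (M - k)%N.
Qed.

Lemma katetov (p : beta S) : injective rk ->
  (forall A, p A -> p (f @^-1` A)) -> p [set x | f x = x].
Proof.
move=> rk_inj pf; apply/not_notP => /betaC nfix.
have [c /(bicolored_not_invariant pf)/betaC ndown] := bicoloring_down.
have [d /(bicolored_not_invariant pf)/betaC nup] := bicoloring_up.
have [x [/= nfx [/negP + /negP]]] := beta_ex (betaI nfix (betaI ndown nup)).
by rewrite -!leqNgt => le1 le2; apply/nfx/rk_inj/eqP; rewrite eqn_leq le1 le2.
Qed.

End Katetov.

(** * Indices of the size of the continuum *)

(** The index set of the size of the continuum. What matters is that it
    surjects onto the sequences of its elements and onto the integers. *)
Definition code : Type := nat -> bool.

Definition code_nth (j : code) (n : nat) : code := fun m => j (pickle (n, m)).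

Lemma code_nth_surj (js : nat -> code) : exists j, code_nth j = js.
Proof.
exists (fun k => if unpickle k is Some (n, m) then js n m else false).
by apply/funext => n; apply/funext => m; rewrite /code_nth pickleK.
Qed.

(** The indicator function of {n} is a code of n. *)
Definition code_nat (j : code) : nat := xget 0%N [set n | j n].

Lemma code_nat_surj n : exists j, code_nat j = n.
Proof.
exists (eq_op^~ n); rewrite /code_nat.
by case: xgetP => [m _ /eqP|/(_ n)/=]; rewrite ?eqxx.
Qed.

(** * An independent family of sets of integers *)

Lemma eventually_all (T : eqType) (s : seq T) (P : T -> nat -> Prop) :
  (forall x, x \in s -> exists N, forall n, (N <= n)%N -> P x n) ->
  exists N, forall n, (N <= n)%N -> forall x, x \in s -> P x n.
Proof.
elim: s => [|y s IHs] ev; first by exists 0%N.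
have [N1 PN1] := ev y (mem_head _ _).
have [|N2 PN2] := IHs; first by move=> x xs; apply: ev; rewrite inE xs orbT.
exists (maxn N1 N2) => n; rewrite geq_max => /andP[le1 le2] x.
by rewrite inE => /predU1P[->|xs]; [exact: PN1 | exact: PN2].
Qed.

Lemma separating_length (s : seq code) :
  exists N, forall n, (N <= n)%N -> forall a, a \in s -> forall b, b \in s ->
    mkseq a n = mkseq b n -> a = b.
Proof.
apply: eventually_all => a _; apply: eventually_all => b _.
have [->|/eqP ab] := pselect (a = b); first by exists 0%N.
have [i abi] : exists i, a i <> b i.
  apply/not_existsP => eqab; apply/(elimN eqP ab)/funext => i.
  exact/not_notP/eqab.
exists i.+1 => n lt_in eq_mk; case: abi.
by rewrite -(nth_mkseq false a lt_in) eq_mk nth_mkseq.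
Qed.

(** The classical independent family: m codes a length n and a finite set l of
    words of length n, and j is tested by whether its prefix of length n is in
    l. Finitely many distinct j have distinct prefixes of all large lengths,
    so that l can be chosen to give each of them any prescribed answer. *)
Definition trace_set (j : code) : set nat :=
  [set m | exists n (l : seq bitseq), m = pickle (n, l) /\ mkseq j n \in l].

Lemma trace_set_independent (Y : set code) :
  exists2 p : beta nat, remainder nat p & forall j, p (trace_set j) <-> Y j.
Proof.
(* A set is in F if, for some finite list s of codes, it contains every pair
   (n, l) with n large enough that gives the prescribed answers on s. *)
pose F (A : set nat) := exists (s : seq code) N,
  forall n (l : seq bitseq), (N <= n)%N ->
  (forall j, j \in s -> mkseq j n \in l <-> Y j) -> A (pickle (n, l)).
have FF : ProperFilter F.
  apply: Build_ProperFilter_ex.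
    move=> A [s [N sA]]; have [N' sep] := separating_length s.
    pose n := maxn N N'; pose l := [seq mkseq j n | j <- s & `[< Y j >]].
    exists (pickle (n, l)); apply: sA => [|j js]; first exact: leq_maxl.
    split=> [/mapP[i]|Yj].
      rewrite mem_filter => /andP[/asboolP Yi si eqij].
      by rewrite (sep n (leq_maxr _ _) j js i si eqij).
    by apply: map_f; rewrite mem_filter js andbT; exact/asboolP.
  split.
  - by exists [::], 0%N.
  - move=> A B [s [N sA]] [t [M tB]]; exists (s ++ t), (maxn N M) => n l.
    rewrite geq_max => /andP[le1 le2] Yst; split; [apply: sA|apply: tB] => //.
      by move=> j js; apply: Yst; rewrite mem_cat js.
    by move=> j js; apply: Yst; rewrite mem_cat js orbT.
  - by move=> A B AB [s [N sA]]; exists s, N => n l Nn Ys; exact/AB/sA.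
have [p Fp] := filter_beta FF; exists p.
  apply: cofinite_remainder => m; apply: Fp.
  (* Beyond the length coded by m, no pair is coded by m. *)
  exists [::], (if unpickle m : option (nat * seq bitseq) is Some (n, _)
    then n.+1 else 0%N) => n l + _ /= mE.
  by rewrite -mE pickleK ltnn.
move=> j; split=> [pj|Yj].
  apply/not_notP => nYj; move: pj; apply/betaC; apply: Fp.
  exists [:: j], 0%N => n l _ Yl [n' [l' [/(pcan_inj pickleK)[<- <-]]]].
  by move=> /(Yl j (mem_head _ _)).
apply: Fp; exists [:: j], 0%N => n l _ Yl; exists n, l; split=> //.
exact/(Yl j (mem_head _ _)).
Qed.

(** * Borel sets as unions of closed sets *)

Definition code_union_closed (T : topologicalType) (A : set T) :=
  exists K : code -> set T, (forall j, closed (K j)) /\ A = \bigcup_j K j.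

Section BorelSets.
Variables (T : topologicalType) (b : code -> set T).
Hypothesis b_closed : forall j, closed (b j).
Hypothesis b_base : forall U x, open U -> U x -> exists2 j, b j x & b j `<=` U.

Lemma open_code_union_closed (U : set T) : open U -> code_union_closed U.
Proof.
move=> Uop; exists (fun j => if `[< b j `<=` U >] then b j else set0); split.
  by move=> j; case: asboolP => _; [exact: b_closed | exact: closed0].
apply/seteqP; split=> [x Ux|x [j _]]; last by case: asboolP => // bU /bU.
by have [j bx /asboolT bU] := b_base Uop Ux; exists j => //; rewrite bU.
Qed.

Lemma bigcup_code_union_closed (A : nat -> set T) :
  (forall n, code_union_closed (A n)) -> code_union_closed (\bigcup_n A n).
Proof.
move=> /choice[K KP].
exists (fun j => K (code_nat (code_nth j 0)) (code_nth j 1)); split.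
  by move=> j; exact: (KP _).1.
apply/seteqP; split=> [x [n _]|x [j _ Kx]].
  rewrite (KP n).2 => -[k _ Kx]; have [i in_] := code_nat_surj n.
  have [j ji] := code_nth_surj (fun m => if m == 0%N then i else k).
  by exists j => //; rewrite ji /= in_.
exists (code_nat (code_nth j 0)) => //.
by rewrite (KP _).2; exists (code_nth j 1).
Qed.

(** Distributivity: a countable intersection of unions is the union, over all
    choices of a sequence of indices, of the intersections; and sequences of
    codes are again coded. *)
Lemma bigcap_code_union_closed (A : nat -> set T) :
  (forall n, code_union_closed (A n)) -> code_union_closed (\bigcap_n A n).
Proof.
move=> /choice[K KP].
exists (fun j => \bigcap_n K n (code_nth j n)); split.
  by move=> j; apply: closed_bigI => n _; exact: (KP _).1.
apply/seteqP; split=> [x Ax|x [j _ Kx] n _]; last first.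
  by rewrite (KP n).2; exists (code_nth j n) => //; exact: Kx.
have /choice[js jsP] n : exists i, K n i x.
  by have := Ax n I; rewrite (KP n).2 => -[i _ Kx]; exists i.
have [j jE] := code_nth_surj js.
by exists j => // n _; rewrite jE.
Qed.

(** A closed set is such a union, but it is not clear from the form of A that
    the complement of A is; hence the induction carries both. *)
Lemma Borel_code_union_closed (A : set T) : Borel A -> code_union_closed A.
Proof.
suff : Borel A -> code_union_closed A /\ code_union_closed (~` A).
  by move=> AP /AP[].
apply: (@smallest_sub _ _ _
  [set B | code_union_closed B /\ code_union_closed (~` B)]) => /=.
  split=> /=.
  - by rewrite setC0; split; apply: open_code_union_closed;
      [exact: open0 | exact: openT].
  - by move=> B [? ?]; rewrite setTD setCK.
  - move=> B BP; rewrite setC_bigcup.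
    split; [apply: bigcup_code_union_closed|apply: bigcap_code_union_closed].
      by move=> n; case: (BP n).
    by move=> n; case: (BP n).
move=> U Uop; split; first exact: open_code_union_closed.
exists (fun=> ~` U); split=> [_|]; first by rewrite closedC.
by apply/seteqP; split=> [x Ux|x [_ _]] //; exists (fun=> true).
Qed.

End BorelSets.

Lemma beta_Borel_code_union (S : Type) (A : set (beta S)) :
  countable [set: S] -> Borel A -> code_union_closed A.
Proof.
move=> /countable_injP[rk rk_inj].
apply: (@Borel_code_union_closed _ (fun j => beta_basic [set x | j (rk x)])).
  by move=> j; exact: beta_basic_closed.
move=> U p Uop /(open_beta_basic Uop)[B pB BU].
pose j n := `[< exists2 x, B x & rk x = n >].
have BE : [set x | j (rk x)] = B.
  apply/seteqP; split=> [x /asboolP[y By /rk_inj <-]|x Bx]; rewrite ?inE //.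
  by apply/asboolP; exists x.
by exists j; rewrite BE.
Qed.

Lemma finite_pieces_enum (T : choiceType) (x0 : T) (K : code -> set T) :
  (forall j, finite_set (K j)) ->
  exists h : code -> T, \bigcup_j K j `<=` range h.
Proof.
move=> Kfin.
have /choice[g gP] j : exists g : nat -> T, K j `<=` range g.
  have /countable_injP[rk rk_inj] := finite_set_countable (Kfin j).
  exists (fun n => xget x0 [set x | K j x /\ rk x = n]) => x Kx.
  exists (rk x) => //; case: xgetP => [y _ [Ky ryx]|/(_ x)]; last by case.
  by apply: rk_inj; rewrite ?inE.
exists (fun j => g (code_nth j 0) (code_nat (code_nth j 1))) => x [k _ Kx].
have [n _ gx] := gP k x Kx; have [i in_] := code_nat_surj n.
have [j ji] := code_nth_surj (fun m => if m == 0%N then k else i).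
by exists j => //; rewrite ji /= in_.
Qed.

(** * Left ideals of beta S *)

Section BetaSemigroup.
Variable S : semigroupType.
Implicit Types (p q r u v y : beta S) (A : set S) (M : set_system S).

Lemma beta_mulE p q A :
  (p * q)%g A <-> p [set x | q [set y | A (x * y)%g]].
Proof. by []. Qed.

Lemma principal_mulE s q A :
  (principal s * q)%g A <-> q [set y | A (s * y)%g].
Proof. exact: principal_filterP. Qed.

(** Right multiplication by v is continuous and beta S is compact, so that
    (beta S) v is closed; it is thus the closure of S v. *)
Lemma orbit_closure r v :
  (forall A, r A -> exists s, (principal s * v)%g A) -> exists u, (u * v)%g = r.
Proof.
move=> rv; pose F (B : set S) :=
  exists2 A, r A & [set s | v [set y | A (s * y)%g]] `<=` B.
have FF : ProperFilter F.
  apply: Build_ProperFilter_ex.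
    by move=> B [A /rv[s /principal_mulE vA] AB]; exists s; exact: AB.
  split.
  - by exists setT => //; exact: filterT.
  - move=> B C [A rA AB] [D rD DC]; exists (A `&` D); first exact: betaI.
    by move=> s vAD; split; [apply: AB|apply: DC]; apply: betaS vAD => y [].
  - by move=> B C BC [A rA AB]; exists A => // s /AB/BC.
have [u Fu] := filter_beta FF; exists u; apply/esym/beta_le_eq => A rA.
by apply/beta_mulE/Fu; exists A.
Qed.

(** The filters that correspond to the closed left ideals: such an ideal is
    the set of ultrafilters finer than a proper left invariant filter. *)
Definition left_invariant M := forall A s, M A -> M [set y | A (s * y)%g].

Lemma left_invariant_mul M u v :
  left_invariant M -> M `<=` v -> M `<=` (u * v)%g.
Proof.
move=> Minv Mv A MA; apply/beta_mulE.
by apply: betaS (@filterT _ u _) => s _; exact/Mv/Minv.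
Qed.

(** The filter of the closed left ideal (beta S) v. *)
Definition orbit_filter v : set_system S :=
  [set A | forall s, v [set y | A (s * y)%g]].

Lemma orbit_filter_proper v : ProperFilter (orbit_filter v).
Proof.
apply: Build_ProperFilter_ex.
  move=> A vA; have [s _] := beta_ex (@filterT _ v _).
  by have [y Ay] := beta_ex (vA s); exists (s * y)%g.
split.
- by move=> s; exact: filterT.
- by move=> A B vA vB s; exact: betaI (vA s) (vB s).
- by move=> A B AB vA s; apply: betaS (vA s) => y; exact: AB.
Qed.

Lemma orbit_filter_invariant v : left_invariant (orbit_filter v).
Proof.
by move=> A s vA t; apply: betaS (vA (s * t)%g) => y /=; rewrite mulgA.
Qed.

(** Maximal left invariant filters are those of the minimal left ideals. The
    union of a chain of proper filters is proper: in terms of closed sets,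
    this is the compactness of beta S. *)
Lemma maximal_left_invariant M0 : ProperFilter M0 -> left_invariant M0 ->
  exists M, [/\ left_invariant M, M0 `<=` M, ProperFilter M &
    forall N, ProperFilter N -> left_invariant N -> M `<=` N -> N = M].
Proof.
move=> M0F M0inv.
pose P M := [/\ ProperFilter M, left_invariant M & M0 `<=` M].
have [||||[M [MF Minv M0M]] Mmax] :=
    @Zorn {M | P M} (fun c d : {M | P M} => `[< sval c `<=` sval d >]).
- by move=> t; exact/asboolP.
- by move=> r s t /asboolP rs /asboolP st; apply/asboolP => A /rs/st.
- move=> [s Ps] [t Pt] /asboolP/= st /asboolP/= ts; apply: eq_exist.
  by apply/seteqP.
- move=> C Ctot; have [[c0 Cc0]|C0] := pselect (C !=set0); last first.
    have P0 : P M0 by split.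
    by exists (exist _ M0 P0) => s Cs; case: C0; exists s.
  pose U : set_system S := [set A | exists2 c, C c & sval c A].
  have PU : P U.
    split.
    + apply: Build_ProperFilter_ex.
        by move=> A [[N [NF ? ?]] _ NA]; exact: (@filter_ex _ N).
      split.
      * by exists c0 => //; case: (svalP c0) => cF _ _; exact: filterT.
      * move=> A B [c Cc cA] [d Cd dB].
        have [/asboolP cd|/asboolP dc] := Ctot c d Cc Cd.
          exists d => //; case: (svalP d) => dF _ _.
          by apply: filterI => //; exact: cd.
        exists c => //; case: (svalP c) => cF _ _.
        by apply: filterI => //; exact: dc.
      * move=> A B AB [c Cc cA]; exists c => //; case: (svalP c) => cF _ _.
        exact: filterS cA.
    + move=> A s [c Cc cA]; exists c => //.
      by case: (svalP c) => _ ci _; exact: ci.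
    + by move=> A M0A; exists c0 => //; case: (svalP c0) => _ _; exact.
  by exists (exist _ U PU) => s Cs; apply/asboolP => A sA; exists s.
exists M; split=> // N NF Ninv MN.
have PN : P N by split=> // A /M0M/MN.
by have /(congr1 sval) := Mmax (exist _ N PN) (asboolT MN).
Qed.

End BetaSemigroup.

(** * Minimal right ideals of the remainder *)

Section Remainder.
Variable S : semigroupType.
Hypothesis S_wcancel : weakly_cancellative S.
Implicit Types (p q r u v y z e : beta S) (A : set S).
Local Notation "S ^*" := (remainder S).

Lemma remainder_mul p q : S^* q -> S^* (p * q)%g.
Proof.
move=> Sq; apply: cofinite_remainder => b; apply/beta_mulE.
apply: betaS (@filterT _ p _) => a _.
exact: remainder_cofinite Sq (S_wcancel a b).1.
Qed.

Variable R : set (beta S).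
Hypothesis R_min : minimal_right_ideal S^* R.

Lemma min_right_ideal_mul q x : R q -> S^* x -> R (q * x)%g.
Proof. by case: R_min => -[_ _ Rmul] _; exact: Rmul. Qed.

Lemma min_right_ideal_remainder q : R q -> S^* q.
Proof. by case: R_min => -[_ RS _] _; exact: RS. Qed.

Lemma min_right_ideal_gen q y : R q -> R y -> exists2 x, S^* x & y = (q * x)%g.
Proof.
move=> Rq Ry; pose R' := [set (q * x)%g | x in S^*].
suff R'E : R' = R by move: Ry; rewrite -R'E => -[x Sx <-]; exists x.
case: (R_min) => _ Rmin; apply: Rmin.
  split; first by exists (q * q)%g, q => //; exact: min_right_ideal_remainder.
    by move=> _ [x Sx <-]; exact: remainder_mul.
  by move=> _ z [x Sx <-] Sz; rewrite -mulgA; exists (x * z)%g => //;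
    exact: remainder_mul.
by move=> _ [x Sx <-]; exact: min_right_ideal_mul.
Qed.

(** Every y in R is of the form e x, since e S^* is a right ideal inside R. *)
Lemma idempotent_left_id e y : idempotents R e -> R y -> (e * y)%g = y.
Proof.
move=> [Re ee] Ry; have [x _ ->] := min_right_ideal_gen Re Ry.
by rewrite mulgA ee.
Qed.

(** A minimal right ideal R meets the closed left ideal defined by M0 in an
    idempotent. Let L be a minimal left ideal inside the latter, and r in the
    intersection of R and L. By minimality r = u (r r) and r = (r r) x for
    some u and x, so u r = u r r x = r x, which lies in R and in L; it is
    idempotent because (u r) (r x) = u (r r x) = u r. *)
Lemma idempotent_above_filter (M0 : set_system S) :
  ProperFilter M0 -> left_invariant M0 -> (forall b, M0 (~` [set b])) ->
  exists2 e, idempotents R e & M0 `<=` e.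
Proof.
move=> M0F M0inv M0cof.
have [M [Minv M0M MF Mmax]] := maximal_left_invariant M0F M0inv.
have orbitE v : M `<=` v -> orbit_filter v = M.
  move=> Mv; apply: Mmax; [exact: orbit_filter_proper|
    exact: orbit_filter_invariant|].
  by move=> A MA s; exact/Mv/Minv.
have [l Ml] := filter_beta MF.
have Sl : S^* l by apply: cofinite_remainder => b; exact/Ml/M0M/M0cof.
have [[[r0 Rr0] _ _] _] := R_min.
pose r := (r0 * l)%g; have Rr : R r by exact: min_right_ideal_mul.
have Mr : M `<=` r by exact: left_invariant_mul.
have Mrr : M `<=` (r * r)%g by exact: left_invariant_mul.
have [u ur] : exists u, (u * (r * r) = r)%g.
  apply: orbit_closure => A rA; apply/not_existsP => nA.
  have : orbit_filter (r * r)%g (~` A).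
    by move=> s; apply/betaC => /(principal_mulE s)/nA.
  by rewrite orbitE // => /Mr/betaC; apply.
have Rrr : R (r * r)%g.
  by apply: min_right_ideal_mul => //; exact: min_right_ideal_remainder.
have [x Sx rx] := min_right_ideal_gen Rrr Rr.
have urx : (u * r = r * x)%g by rewrite {1}rx mulgA ur.
exists (u * r)%g; last by move=> A M0A; exact: left_invariant_mul (M0M _ M0A).
split; first by rewrite urx; exact: min_right_ideal_mul.
by rewrite {2}urx -mulgA (mulgA r) -rx.
Qed.

Hypothesis S_countable : countable [set: S].
Hypothesis S_Fix : exists k : nat, forall a : S, Fix a #<= `I_k.

(** Any k + 1 of the infinitely many t with t y = y fix a common element a of
    S, since each of them fixes y-almost every element. *)
Lemma fixed_by_nonprincipal_many y e :
  S^* e -> e [set t | (principal t * y)%g = y] -> False.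
Proof.
move=> Se eT; have [k Fk] := S_Fix.
have /countable_injP[rk rk_inj] := S_countable.
have : infinite_set [set t | (principal t * y)%g = y].
  by move=> /(remainder_cofinite Se)/betaC.
move=> /infinite_injection[g [g_inj gy]].
pose F i := [set a | (g i * a)%g = a].
have yF i : y (F i).
  apply: (katetov (rk := rk)); first by move=> a b; apply: rk_inj; rewrite inE.
  by move=> A yA; apply/principal_mulE; rewrite gy.
have [a aF] := beta_ex (beta_ord_bigI (n := k.+1) (fun i _ => yF i)).
suff : `I_k.+1 #<= `I_k by rewrite card_le_II ltnn.
apply: card_le_trans (Fk a).
have /card_eqPle[_ gI] : g @` `I_k.+1 #= `I_k.+1.
  by apply: inj_card_eq => i j _ _; exact: g_inj.
apply: card_le_trans gI _; apply: subset_card_le => _ [i ik <-].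
exact: aF.
Qed.

(** A limit y of distinct points of K is fixed on the left by e-almost every t
    in S, where y = q e: otherwise the points of K other than y and the points
    t y other than y would give two separated sequences with y in the closure
    of both. *)
Lemma compact_translate_finite q (K : set (beta S)) : R q -> closed K ->
  K `<=` [set (q * e)%g | e in idempotents R] -> finite_set K.
Proof.
move=> Rq Kcl KqE; apply/not_notP => /infinite_injection[x [x_inj Kx]].
have [p pN] := nonprincipal_nat; have [y yP] := beta_limit p x.
have Ky : K y.
  apply/not_notP => /(closed_beta_sep Kcl)[A /yP pA KA].
  by have [n /KA] := beta_ex pA; apply.
have [e Ee qe] := KqE y Ky; have [Re ee] := Ee.
have Ke z : K z -> (z * e)%g = y.
  by move=> /KqE[f Ef <-]; rewrite -mulgA (idempotent_left_id Ef Re).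
have ye : (y * e)%g = y by exact: Ke.
have Ry : R y by rewrite -qe; apply: min_right_ideal_mul => //;
  exact: min_right_ideal_remainder.
apply: (@fixed_by_nonprincipal_many y e).
  exact: min_right_ideal_remainder.
set T := [set t | _]; apply/not_notP => /betaC enT.
(* At most one x_n is equal to y; it is replaced by the next one, which does
   not change the limit. *)
pose x' n := if x n == y then x n.+1 else x n.
have Kx' n : K (x' n) by rewrite /x'; case: ifP.
have x'y n : x' n <> y.
  rewrite /x'; case: eqP => // xn xSn.
  by have /x_inj/eqP := etrans xn (esym xSn); rewrite ltn_eqF.
have px' : p [set n | x' n = x n].
  apply/not_notP => /betaC px'; have [n0 /= x'n0] := beta_ex px'.
  have pn0 := remainder_cofinite pN (finite_set1 n0).
  have [n [/= x'n]] := beta_ex (betaI px' pn0); apply; apply: x_inj.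
  by move: x'n0 x'n; rewrite /x'; case: eqP => // -> _; case: eqP.
have /countable_injP[rk rk_inj] := S_countable.
have [t0 nT0] := beta_ex enT.
(* An enumeration of the complement of T, with t0 as default value. *)
pose t n := xget t0 [set s | ~ T s /\ rk s = n].
have nTt n : ~ T (t n) by rewrite /t; case: xgetP => // s _ [].
have tE s : ~ T s -> t (rk s) = s.
  move=> nTs; rewrite /t; case: xgetP => [r _ [_ rs]|/(_ s)]; last by case.
  by apply: rk_inj; rewrite ?inE.
have [n|m|D [xD tD]] := @frolik _ x' (fun n => principal (t n) * y)%g.
- apply/not_notP => nsep.
  have [|u uy] := @orbit_closure _ (x' n) y.
    move=> A xA; apply/not_existsP => nA; apply: nsep.
    by exists A => // m; exact: nA.
  by apply: (x'y n); rewrite -(Ke _ (Kx' n)) -uy -mulgA ye.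
- have [|B tyB KB] := closed_beta_sep (p := (principal (t m) * y)%g) Kcl.
    by move=> /Ke; rewrite -mulgA ye; exact: nTt.
  by exists B => // n; exact: KB.
have yD : y D by apply/yP; apply: betaS px' => n /= <-.
suff : y (~` D) by move=> /betaC.
rewrite -(idempotent_left_id Ee Ry); apply/beta_mulE.
by apply: betaS enT => s /tE <-; exact/principal_mulE.
Qed.

End Remainder.

(** * Sparse sequences *)

Section SparseSequence.
Variable S : semigroupType.
Hypothesis S_infinite : infinite_set [set: S].
Hypothesis S_countable : countable [set: S].
Hypothesis S_wcancel : weakly_cancellative S.

(** The term x_n is chosen so that s_i x_n, for i <= n, avoids the finitely
    many products s_j x_m with j <= m < n; by weak cancellation this excludes
    finitely many values of x_n. *)
Lemma sparse_sequence : exists s x : nat -> S, (forall a, exists i, s i = a) /\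
  forall i j m n, (i <= n)%N -> (j <= m)%N ->
    (s i * x n = s j * x m)%g -> m = n.
Proof.
have /infinite_injection[g _] := S_infinite.
have /countable_injP[rk rk_inj] := S_countable.
pose s i := xget (g 0%N) [set a | rk a = i].
have s_surj a : exists i, s i = a.
  exists (rk a); rewrite /s; case: xgetP => [b _ rkb|/(_ a)]; last by case.
  by apply: rk_inj; rewrite ?inE.
have /choice[pick pickP] (nF : nat * seq S) : exists x : S,
    forall i, (i <= nF.1)%N -> (s i * x)%g \notin nF.2.
  case: nF => n F /=.
  have : finite_set (\bigcup_(i in `I_n.+1) \bigcup_(b in [set` F])
      [set x | s i * x = b]%g).
    apply: bigcup_finite => // i _; apply: bigcup_finite => // b _.
    exact: (S_wcancel (s i) b).1.
  move=> Ffin; apply/not_existsP => nF; apply: S_infinite.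
  apply: sub_finite_set Ffin => x _.
  have /existsNP[i /not_implyP[le_in]] := nF x.
  by move=> /negP; rewrite negbK => Fx; exists i => //; exists (s i * x)%g.
(* F n lists the products s_j x_m with j <= m < n. *)
pose fix F n := if n is m.+1 then
  F m ++ [seq (s j * pick (m, F m))%g | j <- iota 0 m.+1] else [::].
pose x n := pick (n, F n).
have Fx j m n : (j <= m)%N -> (m < n)%N -> (s j * x m)%g \in F n.
  move=> le_jm; elim: n => // n IHn; rewrite ltnS leq_eqVlt mem_cat.
  move=> /predU1P[<-|/IHn -> //]; apply/orP; right.
  by apply/mapP; exists j; rewrite ?mem_iota.
have lt_absurd i j m n : (i <= n)%N -> (j <= m)%N -> (m < n)%N ->
    (s i * x n <> s j * x m)%g.
  move=> le_in le_jm lt_mn eqx; have := pickP (n, F n) i le_in.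
  by rewrite -/(x n) eqx Fx.
exists s, x; split=> // i j m n le_in le_jm eqx; case: (ltngtP m n) => // lt.
  by case: (lt_absurd i j m n).
by case: (lt_absurd j i n m).
Qed.

(** The filter M is that of the closed left ideal generated by the image of p
    under a sparse sequence x, and P B consists of the products s_i x_n with
    n in B and i <= n. Disjointness of P B and P (~` B) means that any
    ultrafilter finer than M determines p. *)
Lemma ultrafilter_coding : exists P : set nat -> set S,
  (forall B, P B `&` P (~` B) = set0) /\
  forall p : beta nat, remainder nat p -> exists M : set_system S,
    [/\ ProperFilter M, left_invariant M, (forall b, M (~` [set b])) &
        forall B, p B -> M (P B)].
Proof.
have [s [x [s_surj sx_inj]]] := sparse_sequence.
exists (fun B => [set a | exists n i, [/\ (i <= n)%N, B n & a = s i * x n]%g]).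
split=> [B|p pN].
  rewrite -subset0 => a [[n [i [le_in Bn ->]]] [m [j [le_jm nBm eqx]]]].
  by apply: nBm; rewrite (sx_inj _ _ _ _ le_in le_jm eqx).
have p_ge i : p [set n | (i <= n)%N].
  apply: betaS (remainder_cofinite pN (finite_II i)) => n /= /negP.
  by rewrite -leqNgt.
exists [set A | forall a, p [set n | A (a * x n)%g]]; split.
- apply: Build_ProperFilter_ex => [A MA|].
    by have [n Ax] := beta_ex (MA (s 0%N)); exists (s 0 * x n)%g.
  split.
  + by move=> a; exact: filterT.
  + by move=> A B MA MB a; exact: betaI (MA a) (MB a).
  + by move=> A B AB MA a; apply: betaS (MA a) => n; exact: AB.
- by move=> A a MA b; apply: betaS (MA (a * b)%g) => n /=; rewrite mulgA.
- move=> b a; have [i <-] := s_surj a; apply/betaC => pb.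
  have [m [/= eqm le_im]] := beta_ex (betaI pb (p_ge i)).
  have [n [/= eqn le_in]] := beta_ex (betaI pb (p_ge m.+1)).
  have le_in' : (i <= n)%N by rewrite (leq_trans le_im) // ltnW.
  have eqmn : m = n.
    by apply: (sx_inj i i) => //; rewrite eqm.
  by move: le_in; rewrite eqmn ltnn.
- move=> B pB a; have [i <-] := s_surj a.
  by apply: betaS (betaI pB (p_ge i)) => n [Bn le_in]; exists n, i.
Qed.

End SparseSequence.

(** * The sets of idempotents are not Borel *)

(** The set of the j with trace_set j in p is chosen so that no h j contains
    the sets P B with B in p; but q e does, for an idempotent e of R above
    the filter attached to p. *)
Lemma translate_not_Borel (S : semigroupType)
  (S_infinite : infinite_set [set: S])
  (S_countable : countable [set: S])
  (S_wcancel : weakly_cancellative S)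
  (S_Fix : exists k : nat, forall a : S, Fix a #<= `I_k)
  (R : set (beta S)) (R_min : minimal_right_ideal (remainder S) R) q : R q ->
  ~ Borel [set (q * e)%g | e in idempotents R].
Proof.
move=> Rq /(beta_Borel_code_union S_countable)[K [Kcl WE]].
have Kfin j : finite_set (K j).
  apply: (compact_translate_finite S_wcancel R_min S_countable S_Fix Rq) => //.
  by rewrite WE => z Kz; exists j.
have [h hP] := finite_pieces_enum q Kfin.
have [P [PC PM]] := ultrafilter_coding S_infinite S_countable S_wcancel.
have [p pN pY] := trace_set_independent [set j | ~ h j (P (trace_set j))].
have [M [MF Minv Mcof MP]] := PM p pN.
have [e Ee Me] := idempotent_above_filter S_wcancel R_min MF Minv Mcof.
have qeM : M `<=` (q * e)%g by exact: left_invariant_mul.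
have [|j _ hj] := hP (q * e)%g; first by rewrite -WE; exists e.
have [pj|npj] := pselect (p (trace_set j)).
  by move/pY: (pj); apply; rewrite hj; exact/qeM/MP.
have hjP : h j (P (trace_set j)) by apply/not_notP => /pY.
have hjC : h j (P (~` trace_set j)) by rewrite hj; exact/qeM/MP/betaC.
by have := beta_ex (betaI hjP hjC); rewrite PC => -[].
Qed.

Theorem corollary3p15 (S : semigroupType)
  (S_infinite : infinite_set [set: S])
  (S_countable : countable [set: S])
  (S_wcancel : weakly_cancellative S)
  (S_Fix : exists k : nat, forall a : S, Fix a #<= `I_k)
  (R : set (beta S)) (R_min : minimal_right_ideal (remainder S) R) :
  ~ Borel (idempotents R) /\
  forall q : beta S, R q ->
    ~ Borel [set (q * e)%g | e in idempotents R].
Proof.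
split; last by move=> q; exact: translate_not_Borel.
move=> ER_Borel.
(* Any nonprincipal p serves: the filter attached to it provides an idempotent
   e of R, and E(R) = e E(R). *)
have [P [_ PM]] := ultrafilter_coding S_infinite S_countable S_wcancel.
have [p pN] := nonprincipal_nat; have [M [MF Minv Mcof _]] := PM p pN.
have [e Ee _] := idempotent_above_filter S_wcancel R_min MF Minv Mcof.
apply: (translate_not_Borel S_infinite S_countable S_wcancel S_Fix R_min Ee.1).
suff -> : [set (e * f)%g | f in idempotents R] = idempotents R by [].
have eE f : idempotents R f -> (e * f = f)%g.
  by move=> [Rf _]; exact: (idempotent_left_id S_wcancel R_min).
apply/seteqP; split=> [_ [f Ef <-]|f Ef]; first by rewrite eE.
by exists f => //; exact: eE.
Qed.
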